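(* Let $n$ be a power of a prime $p$, $q=n^2$, and $K$ an algebraic closure of $\mathbb{F}_q$. Let $\mathcal H_n$ be the Hermitian curve $Y^nZ+YZ^n-X^{n+1}=0$ and let $\mathrm{PGU}(3,n)$ be the subgroup of $\mathrm{PGL}(3,q)$ leaving $\mathcal H_n$ invariant, acting on $\mathrm{PG}(2,K)$. Then $d(\mathrm{PGU}(3,n))=n+1$, $\varepsilon(\mathrm{PGU}(3,n))=qn-n$, and $\mathcal H_n$ is the only $\mathrm{PGU}(3,n)$-invariant irreducible plane curve of degree $n+1$.
   Context: Plane curves are over $K$; irreducible means irreducible over $K$; $G$-invariant means mapped onto itself by every element of $G$. $d(G)$ is the smallest degree of a $G$-invariant irreducible plane curve other than a line; $\varepsilon(G)=d'(G)-d(G)$ where $d'(G)$ is the smallest degree larger than $d(G)$ of a $G$-invariant irreducible plane curve. *)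

(* Defs.v *)
From HB Require Import structures.
From mathcomp Require Import all_boot all_order all_algebra.
From mathcomp Require Import mpoly.
Set Implicit Arguments. Unset Strict Implicit. Unset Printing Implicit Defensive.
Import Order.TTheory GRing.Theory.
Local Open Scope ring_scope.

(* Homogeneous coordinates: 'X_0 = X, 'X_1 = Y, 'X_2 = Z. *)

Definition herm_poly (K : fieldType) (n : nat) : {mpoly K[3]} :=
  'X_(1 : 'I_3) ^+ n * 'X_(2 : 'I_3) + 'X_(1 : 'I_3) * 'X_(2 : 'I_3) ^+ n
  - 'X_(0 : 'I_3) ^+ n.+1.

(* Substitution of the linear change of coordinates given by M:
   F |-> F(M (X,Y,Z)^T).  The image of the curve F = 0 under the projectivity
   induced by M is the curve (F o M^-1) = 0. *)
Definition mat_act (K : fieldType) (M : 'M[K]_3) (F : {mpoly K[3]}) : {mpoly K[3]} :=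
  F \mPo [tuple \sum_(j < 3) M i j *: 'X_j | i < 3].

(* M is a matrix of PGL(3,q) (q = n^2), i.e. invertible with entries in F_q,
   leaving the Hermitian curve invariant.  PGU(3,n) is the image of these
   matrices in PGL(3,q). *)
Definition in_PGU (K : fieldType) (n : nat) (M : 'M[K]_3) : Prop :=
  [/\ M \in unitmx,
      (forall i j, M i j ^+ (n ^ 2) = M i j) &
      exists c : K, mat_act M (herm_poly K n) = c *: herm_poly K n].

(* A plane curve of degree d: a nonzero homogeneous form of degree d
   (taken up to a nonzero scalar). *)
Definition plane_curve_of_degree (K : fieldType) (d : nat) (F : {mpoly K[3]}) : Prop :=
  F != 0 /\ F \is d.-homog.

Definition mirreducible (K : fieldType) (F : {mpoly K[3]}) : Prop :=
  (1 < msize F)%N /\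
  forall A B : {mpoly K[3]}, F = A * B -> (msize A <= 1)%N \/ (msize B <= 1)%N.

Definition PGU_invariant (K : fieldType) (n : nat) (F : {mpoly K[3]}) : Prop :=
  forall M : 'M[K]_3, in_PGU n M -> exists c : K, mat_act M F = c *: F.

Definition inv_irr_curve (K : fieldType) (n d : nat) (F : {mpoly K[3]}) : Prop :=
  [/\ plane_curve_of_degree d F, mirreducible F & PGU_invariant n F].
Arguments herm_poly K n : clear implicits.

(* Main.v *)
Require Import Defs.
From HB Require Import structures.
From mathcomp Require Import all_boot all_order all_algebra.
From mathcomp Require Import mpoly.
From mathcomp Require Import cyclic separable ring zify.
Set Implicit Arguments. Unset Strict Implicit. Unset Printing Implicit Defensive.
Import Order.TTheory GRing.Theory.
Local Open Scope ring_scope.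

(* The Hermitian form H_N is irreducible for every N > 1: in H_N = A B one factor, say A, does not
   vanish at (0,0,1) since Y^N + Y has a simple root at 0; then A(X,0,1) divides X^(N+1), so it is
   constant and B has full degree.  A matrix over F_q preserving H_n up to a scalar preserves H_{n^3}
   up to the same scalar, since c^(n^3) = c^n on F_q; this is the invariant curve of degree n^3 + 1.

   Let F be invariant, irreducible, of degree 1 < d <= n^3.  The homologies X -> zX with z^(n+1) = 1
   force all exponents of X in F to be congruent mod n+1, hence divisible by n+1 as X does not divide F;
   so F = H_n Q + a(Y,Z) with a a binary form of degree d; put A(y) = a(y,1).  The unipotent elements
   fixing (0,1,0) carry (0,0,1) to all n^3 affine rational points (b,c,1), and comparing n-jets along
   the curve shows that (y-c)^(n+1) divides A(y) - A(0), or only y-c when c^n + c = 0.  These orders add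
   up to n^3, so A is constant or d = n^3.  Swapping Y and Z, which exchanges A_0 and A_d up to a scalar
   and relates A(1/y) to A(y), then gives A = 0.  Hence H_n divides F. *)

(** * Restriction of forms to parametrized curves *)

(** Values in [{poly K}] treat points (constant triples), lines and jets along the curve in the same
    way. *)
Definition ev3 (K : fieldType) (u v w : {poly K}) : {mpoly K[3]} -> {poly K} :=
  mmap polyC (tnth [tuple u; v; w]).

HB.instance Definition _ (K : fieldType) (u v w : {poly K}) :=
  GRing.RMorphism.on (ev3 u v w).

Lemma ev3Z (K : fieldType) (u v w : {poly K}) c F :
  ev3 u v w (c *: F) = c *: ev3 u v w F.
Proof. by rewrite /ev3 mmapZ mul_polyC. Qed.

Lemma ev3X (K : fieldType) (u v w : {poly K}) i :
  ev3 u v w 'X_i = tnth [tuple u; v; w] i.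
Proof. by rewrite /ev3 mmapX mmap1U. Qed.

Lemma ev3E (K : fieldType) (u v w : {poly K}) F : ev3 u v w F =
  \sum_(m <- msupp F) F@_m *: (u ^+ m 0 * v ^+ m 1 * w ^+ m 2).
Proof.
rewrite /ev3 /mmap; apply: eq_bigr => m _.
rewrite mul_polyC /mmap1 !big_ord_recl big_ord0 mulr1 mulrA /=.
by congr (_ *: (_ ^+ m _ * _ ^+ m _ * _ ^+ m _)); apply: val_inj.
Qed.

Lemma ev3_herm (K : fieldType) (n : nat) (u v w : {poly K}) :
  ev3 u v w (herm_poly K n) = v ^+ n * w + v * w ^+ n - u ^+ n.+1.
Proof.
by rewrite /herm_poly rmorphB rmorphD !rmorphM !rmorphXn /= !ev3X.
Qed.

Lemma ev3_mat_act (K : fieldType) (M : 'M[K]_3) (u v w : {poly K}) F :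
  let l i := M i 0 *: u + M i 1 *: v + M i 2 *: w in
  ev3 u v w (mat_act M F) = ev3 (l 0) (l 1) (l 2) F.
Proof.
move=> l; rewrite /mat_act comp_mpolyE raddf_sum ev3E; apply: eq_bigr => m _.
rewrite /= ev3Z !big_ord_recl big_ord0 mulr1 !rmorphM !rmorphXn /= mulrA.
rewrite !tnth_mktuple.
have E i : ev3 u v w (\sum_(j < 3) M i j *: 'X_j) = l i.
  rewrite raddf_sum !big_ord_recl big_ord0 addr0 /= !ev3Z !ev3X addrA.
  by congr (M i _ *: _ + M i _ *: _ + M i _ *: _); apply: val_inj.
by rewrite !E; congr (_ *: (l _ ^+ m _ * l _ ^+ m _ * l _ ^+ m _)); apply: val_inj.
Qed.

(** * Irreducibility of the Hermitian form *)

Lemma size_ev3_X01 (K : fieldType) (F : {mpoly K[3]}) :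
  (size (ev3 'X 0 1 F) <= msize F)%N.
Proof.
rewrite ev3E big_seq; apply: (leq_trans (size_sum _ _ _)).
apply/bigmax_leqP_seq => m mF _.
apply: (leq_trans (size_scale_leq _ _)).
have le_m : (m 0%R < msize F)%N.
  apply: leq_trans (msize_mdeg_lt mF).
  by rewrite ltnS mdegE (bigD1 0%R) //= leq_addr.
rewrite expr1n mulr1 expr0n; case: eqP => _; rewrite ?mulr0 ?size_poly0 //.
by rewrite mulr1 size_polyXn.
Qed.

Lemma herm_homog (K : fieldType) (n : nat) : herm_poly K n \is n.+1.-homog.
Proof.
have X1 (i : 'I_3) : ('X_i : {mpoly K[3]}) \is 1.-homog by rewrite dhomogX /= mdeg1.
have XE (i : 'I_3) m : ('X_i ^+ m : {mpoly K[3]}) \is m.-homog.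
  by rewrite -[X in X.-homog]mul1n dhomogMn.
apply: rpredB; last exact: XE.
apply: rpredD.
- by have := dhomogM (XE 1 n) (X1 2); rewrite addn1.
- by have := dhomogM (X1 1) (XE 2 n); rewrite add1n.
Qed.

Lemma ev3_herm_X01 (K : fieldType) (n : nat) : (0 < n)%N ->
  ev3 'X 0 1 (herm_poly K n) = - 'X^(n.+1).
Proof. by move=> n0; rewrite ev3_herm expr0n (gtn_eqF n0) !mul0r add0r sub0r. Qed.

Lemma herm_neq0 (K : fieldType) (n : nat) : (0 < n)%N -> herm_poly K n != 0.
Proof.
move=> n0; apply/eqP => H0; have := @ev3_herm_X01 K n n0.
by rewrite H0 raddf0 => /eqP; rewrite eq_sym oppr_eq0 -size_poly_eq0 size_polyXn.
Qed.

Lemma msize_dhomog (K : fieldType) d (F : {mpoly K[3]}) :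
  F != 0 -> F \is d.-homog -> msize F = d.+1.
Proof.
move=> F0 Fd; have := dhomog_msize Fd; move/(dhomog_uniq F0 Fd) => ->.
by rewrite prednK // lt0n msize_poly_eq0.
Qed.

(** The line Y = 0 is the tangent at (0,0,1) and meets the curve only there, so a factor of H_n
    restricts to it as a power of X, up to a constant. If that power is trivial for A, then B
    restricts to degree n+1 and leaves no degree for A. *)
Lemma herm_factor (K : fieldType) (n : nat) (A B : {mpoly K[3]}) :
  (0 < n)%N -> herm_poly K n = A * B -> (ev3 'X 0 1 A).[0] != 0 ->
  (msize A <= 1)%N.
Proof.
move=> n0 HAB A0.
have H0 := herm_neq0 K n0.
have [nA nB] : A != 0 /\ B != 0.
  by apply/andP; rewrite -negb_or -mulf_eq0 -HAB.
have E : ev3 'X 0 1 A * ev3 'X 0 1 B = - 'X^(n.+1).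
  by rewrite -rmorphM -HAB /= ev3_herm_X01.
have : ev3 'X 0 1 A %| ('X - 0%:P) ^+ n.+1.
  by rewrite subr0 -dvdpNr -E dvdp_mulr.
case/dvdp_exp_XsubCP => k _; rewrite subr0.
have Anz : ev3 'X 0 1 A != 0 by apply: contraNneq A0 => ->; rewrite horner0.
have Bnz : ev3 'X 0 1 B != 0.
  apply/eqP => B0; move/eqP: E; rewrite B0 mulr0 eq_sym oppr_eq0.
  by rewrite -size_poly_eq0 size_polyXn.
case: k => [|k] Ak; last first.
  move: A0; suff -> : (ev3 'X 0 1 A).[0] = 0 by rewrite eqxx.
  apply/eqP; rewrite -[_ == 0]/(root _ _) (eqp_root Ak).
  by rewrite /root hornerXn expr0n.
have sA : size (ev3 'X 0 1 A) = 1%N by rewrite (eqp_size Ak) expr0 size_poly1.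
have : size (ev3 'X 0 1 A * ev3 'X 0 1 B) = n.+2 by rewrite E size_polyN size_polyXn.
rewrite size_mul // sA add1n /= => sB.
have := size_ev3_X01 B; rewrite sB => mB.
have := msize_dhomog H0 (herm_homog K n).
rewrite HAB msizeM //; move: mB; set a := msize A; set b := msize B; clearbody a b; clear; lia.
Qed.

Lemma herm_irreducible (K : fieldType) (n : nat) :
  (1 < n)%N -> mirreducible (herm_poly K n).
Proof.
move=> n1; have n0 := ltnW n1.
split; first by rewrite (msize_dhomog (herm_neq0 K n0) (herm_homog K n)).
move=> A B HAB.
have [A0|A0] := eqVneq (ev3 'X 0 1 A).[0] 0; last by left; apply: (herm_factor n0 HAB).
right; apply: (@herm_factor K n B A) => //; first by rewrite HAB mulrC.
apply/negP => /eqP B0.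
(* both factors would vanish to first order at (0,0,1), whereas Y^n + Y has a simple root *)
have ev0 F : (ev3 0 'X 1 F).[0] = (ev3 'X 0 1 F).[0].
  rewrite !ev3E !horner_sum; apply: eq_bigr => m _.
  by rewrite !hornerE.
have E : ev3 0 'X 1 A * ev3 0 'X 1 B = 'X^n + 'X :> {poly K}.
  by rewrite -rmorphM -HAB /= ev3_herm !expr1n !mulr1 expr0n subr0.
have /factor_theorem [a Ea] : root (ev3 0 'X 1 A) 0 by rewrite /root ev0 A0.
have /factor_theorem [b Eb] : root (ev3 0 'X 1 B) 0 by rewrite /root ev0 B0.
(* The product of two multiples of X has no linear term, but X^n + X has one because n > 1. *)
move: E; rewrite Ea Eb subr0 => /(congr1 (fun p : {poly K} => p`_1)).
rewrite mulrACA -expr2 coefMXn /= coefD coefXn coefX /=.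
by rewrite (ltn_eqF n1) add0r => /eqP; rewrite eq_sym oner_eq0.
Qed.

(** * Additivity of n-th powers and the invariant curve of degree n^3 + 1 *)

Lemma exprD_pchar_exp (S : comNzRingType) p k (x y : S) :
  p \in [pchar S] -> (x + y) ^+ (p ^ k) = x ^+ (p ^ k) + y ^+ (p ^ k).
Proof.
move=> pS; apply: exprDn_pchar.
by rewrite pnatX (eq_pnat _ (pcharf_eq pS)) pnat_id // (pcharf_prime pS).
Qed.

Lemma expr_sum_pchar (S : comNzRingType) p k (I : finType) (x : I -> S) :
  p \in [pchar S] -> (\sum_i x i) ^+ (p ^ k) = \sum_i x i ^+ (p ^ k).
Proof.
move=> pS; apply: (big_morph (fun z => z ^+ (p ^ k))) => [y z|].
  exact: exprD_pchar_exp.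
by rewrite expr0n expn_eq0 (gtn_eqF (prime_gt0 (pcharf_prime pS))).
Qed.

Lemma exprN_pchar_exp (S : comNzRingType) p k (x : S) :
  p \in [pchar S] -> (- x) ^+ (p ^ k) = - x ^+ (p ^ k).
Proof.
move=> pS; apply/eqP; rewrite -addr_eq0 addrC -exprD_pchar_exp // subrr.
by rewrite expr0n expn_eq0 (gtn_eqF (prime_gt0 (pcharf_prime pS))).
Qed.

Lemma exprB_pchar_exp (S : comNzRingType) p k (x y : S) :
  p \in [pchar S] -> (x - y) ^+ (p ^ k) = x ^+ (p ^ k) - y ^+ (p ^ k).
Proof. by move=> pS; rewrite exprD_pchar_exp // exprN_pchar_exp. Qed.

Lemma mat_act1 (K : fieldType) (F : {mpoly K[3]}) : mat_act 1%:M F = F.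
Proof.
rewrite /mat_act -[RHS]comp_mpoly_id; congr (_ \mPo _).
apply: eq_from_tnth => i; rewrite !tnth_mktuple (bigD1 i) //= big1 => [|j ji].
  by rewrite mxE eqxx scale1r addr0.
by rewrite mxE eq_sym (negPf ji) scale0r.
Qed.

(** With s(x,y) = x_1^n y_2 + x_2^n y_1 - x_0^n y_0, so that H_n(x) = s(x,x), this is s evaluated at
    columns j and l of M. *)
Definition gram (K : fieldType) (n : nat) (M : 'M[K]_3) (j l : 'I_3) : K :=
  M 1 j ^+ n * M 2 l + M 2 j ^+ n * M 1 l - M 0 j ^+ n * M 0 l.

(** As n is a power of p, the n-th power of a linear form is the sum of the n-th powers of its
    terms. *)
Lemma mat_act_herm (K : fieldType) p k (M : 'M[K]_3) : p \in [pchar K] ->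
  mat_act M (herm_poly K (p ^ k)) =
  \sum_j \sum_l gram (p ^ k) M j l *: ('X_j ^+ (p ^ k) * 'X_l).
Proof.
move=> pK; set n := (p ^ k)%N; pose L i := \sum_(j < 3) M i j *: 'X_j : {mpoly K[3]}.
have -> : mat_act M (herm_poly K n) = L 1 ^+ n * L 2 + L 2 ^+ n * L 1 - L 0 ^+ n * L 0.
  rewrite /mat_act /herm_poly rmorphB rmorphD !rmorphM !rmorphXn /=.
  by rewrite !comp_mpolyXU !(nth_mktuple _ _ (_ : 'I_3)) exprSr [L 1 * _]mulrC.
have pS : p \in [pchar {mpoly K[3]}] by apply: (rmorph_pchar (@mpolyC 3 K)).
have LL a b : L a ^+ n * L b =
    \sum_j \sum_l (M a j ^+ n * M b l) *: ('X_j ^+ n * 'X_l).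
  rewrite expr_sum_pchar // big_distrl; apply: eq_bigr => j _.
  rewrite big_distrr; apply: eq_bigr => l _ /=.
  by rewrite exprZn -scalerAl -scalerAr scalerA.
rewrite !LL -big_split -sumrB; apply: eq_bigr => j _ /=.
rewrite -big_split -sumrB; apply: eq_bigr => l _ /=.
by rewrite -scalerDl -scalerBl.
Qed.

(** For n > 1 the nine monomials X_j^n X_l are pairwise distinct. *)
Lemma gram_form_inj (K : fieldType) n (C D : 'I_3 -> 'I_3 -> K) : (1 < n)%N ->
  \sum_j \sum_l C j l *: ('X_j ^+ n * 'X_l : {mpoly K[3]}) =
  \sum_j \sum_l D j l *: ('X_j ^+ n * 'X_l) -> C =2 D.
Proof.
move=> n1 CD j l; move/(congr1 (fun P => P@_(U_(j) *+ n + U_(l))%MM)): CD.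
have E (B : 'I_3 -> 'I_3 -> K) :
    (\sum_j \sum_l B j l *: ('X_j ^+ n * 'X_l : {mpoly K[3]}))@_(U_(j) *+ n + U_(l))%MM = B j l.
  rewrite raddf_sum (bigD1 j) //= raddf_sum (bigD1 l) //=.
  have coef i i' : (B i i' *: ('X_i ^+ n * 'X_i' : {mpoly K[3]}))@_(U_(j) *+ n + U_(l))%MM
      = B i i' * ((i == j) && (i' == l))%:R.
    rewrite mpolyXn -mpolyXD mcoeffZ mcoeffX; congr (_ * (nat_of_bool _)%:R).
    apply/eqP/andP => [H|[/eqP-> /eqP->] //].
    have Hx x : (((i == x) * n + (i' == x)) = ((j == x) * n + (l == x)))%N.
      move/mnmP/(_ x): H; rewrite !mnmDE !mulmnE !mnm1E; lia.
    have ij : i == j by move: (Hx j); rewrite eqxx; case: (i == j) => //; lia.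
    split=> //; move: (Hx l); rewrite (eqP ij) eqxx; lia.
  rewrite coef !eqxx mulr1 !big1 ?addr0 // => [i ij|i il].
    by rewrite raddf_sum big1 // => i' _ /=; rewrite coef (negPf ij) mulr0.
  by rewrite coef (negPf il) andbF mulr0.
by rewrite !E.
Qed.

Lemma herm_cube_invariant (K : fieldType) p k : (0 < k)%N -> p \in [pchar K] ->
  PGU_invariant (p ^ k) (herm_poly K ((p ^ k) ^ 3)).
Proof.
move=> k0 pK M [_ Mq [c Mc]]; exists c; set n := (p ^ k)%N in Mq Mc *.
have n1 : (1 < n)%N.
  by rewrite /n -{1}(expn0 p) ltn_exp2l // prime_gt1 // (pcharf_prime pK).
(* Comparing coefficients turns invariance of H_n into proportionality of Gram matrices. *)
have Ec (j l : 'I_3) : gram n M j l = c * gram n 1%:M j l.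
  move: j l; apply: (gram_form_inj n1).
  rewrite -mat_act_herm // Mc -[herm_poly K n]mat_act1 mat_act_herm // scaler_sumr.
  by apply: eq_bigr => j _; rewrite scaler_sumr; apply: eq_bigr => l _; rewrite scalerA.
have cube (x : K) : x ^+ (n ^ 2) = x -> x ^+ (n ^ 3) = x ^+ n.
  by move=> xq; rewrite (expnD n 2 1) exprM xq.
have gram3 (A : 'M[K]_3) : (forall i j, A i j ^+ (n ^ 2) = A i j) ->
    gram (n ^ 3) A =2 gram n A.
  by move=> Aq j l; rewrite /gram !cube.
have one3 : gram (n ^ 3) (1%:M : 'M[K]_3) =2 gram n 1%:M.
  apply: gram3 => i j; rewrite mxE; case: eqP => _; rewrite ?expr1n //.
  by rewrite expr0n expn_eq0 (gtn_eqF (ltnW n1)).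
(* The cube of n is written as [p ^ (k * 3)], the shape that [mat_act_herm] needs. *)
rewrite -[X in _ = c *: X]mat_act1 -expnM !mat_act_herm // expnM scaler_sumr.
apply: eq_bigr => j _; rewrite scaler_sumr; apply: eq_bigr => l _.
by rewrite scalerA gram3 // one3 Ec.
Qed.

(** * Explicit elements of PGU(3,n) *)

Definition mx3 (K : fieldType) (rows : seq (seq K)) : 'M[K]_3 :=
  \matrix_(i < 3, j < 3) (nth [::] rows i)`_j.

(** The matrices below preserve H_n with scalar 1, and an explicit inverse [N] spares the
    determinant. *)
Lemma in_PGU_gram (K : fieldType) p k (M N : 'M[K]_3) : p \in [pchar K] ->
  M *m N = 1%:M -> (forall i j, M i j ^+ ((p ^ k) ^ 2) = M i j) ->
  gram (p ^ k) M =2 gram (p ^ k) 1%:M -> in_PGU (p ^ k) M.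
Proof.
move=> pK /mulmx1_unit [uM _] Mq gM; split=> //; exists 1.
rewrite scale1r -[RHS]mat_act1 !mat_act_herm //.
by apply: eq_bigr => j _; apply: eq_bigr => l _; rewrite gM.
Qed.

Lemma swap_in_PGU (K : fieldType) p k : p \in [pchar K] ->
  in_PGU (p ^ k) (mx3 [:: [:: 1; 0; 0]; [:: 0; 0; 1]; [:: 0; 1; 0]] : 'M[K]_3).
Proof.
move=> pK; set M := mx3 _; have n0 : (0 < p ^ k)%N.
  by rewrite expn_gt0 prime_gt0 // (pcharf_prime pK).
have n2 : (0 < (p ^ k) ^ 2)%N by rewrite expn_gt0 n0.
apply: (@in_PGU_gram _ _ _ _ M) => //.
- apply/matrixP => i j; rewrite !mxE !big_ord_recl big_ord0 !mxE.
  by case: i j => [[|[|[|//]]] ?] [[|[|[|//]]] ?] /=; ring.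
- move=> i j; rewrite !mxE; case: i j => [[|[|[|//]]] ?] [[|[|[|//]]] ?] /=;
  by rewrite ?expr1n ?expr0n ?(gtn_eqF n2).
- move=> j l; rewrite /gram !mxE.
  by case: j l => [[|[|[|//]]] ?] [[|[|[|//]]] ?] /=;
     rewrite ?expr1n ?expr0n ?(gtn_eqF n0) /=; ring.
Qed.

Lemma homology_in_PGU (K : fieldType) p k (z : K) : p \in [pchar K] ->
  z ^+ (p ^ k).+1 = 1 ->
  in_PGU (p ^ k) (mx3 [:: [:: z; 0; 0]; [:: 0; 1; 0]; [:: 0; 0; 1]]).
Proof.
move=> pK z1; have n0 : (0 < p ^ k)%N.
  by rewrite expn_gt0 prime_gt0 // (pcharf_prime pK).
have n2 : (0 < (p ^ k) ^ 2)%N by rewrite expn_gt0 n0.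
have z0 : z != 0.
  by apply/eqP => z0; move/eqP: z1; rewrite z0 expr0n eq_sym oner_eq0.
(* Multiplied by z^n, both sides become 1, since n^2 + n = n(n+1). *)
have zq : z ^+ ((p ^ k) ^ 2) = z.
  apply: (mulIf (expf_neq0 (p ^ k) z0)); rewrite -exprS z1 -exprD.
  by rewrite addnC -mulnn -mulnS mulnC exprM z1 expr1n.
apply: (@in_PGU_gram _ _ _ _ (mx3 [:: [:: z^-1; 0; 0]; [:: 0; 1; 0]; [:: 0; 0; 1]])) => //.
- apply/matrixP => i j; rewrite !mxE !big_ord_recl big_ord0 !mxE.
  by case: i j => [[|[|[|//]]] ?] [[|[|[|//]]] ?] /=; field.
- move=> i j; rewrite !mxE; case: i j => [[|[|[|//]]] ?] [[|[|[|//]]] ?] /=;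
  by rewrite ?expr1n ?expr0n ?(gtn_eqF n2).
- move=> j l; rewrite /gram !mxE.
  by case: j l => [[|[|[|//]]] ?] [[|[|[|//]]] ?] /=;
     rewrite ?expr1n ?expr0n ?(gtn_eqF n0) -?exprSr ?z1 /=; ring.
Qed.

(** The relation between [b] and [c] puts (b,c,1), the image of (0,0,1), on the curve. The entry b^n
    cancels the terms X^n Z and X Z^n. *)
Lemma unipotent_in_PGU (K : fieldType) p k (b c : K) : p \in [pchar K] ->
  b ^+ ((p ^ k) ^ 2) = b -> c ^+ ((p ^ k) ^ 2) = c ->
  c ^+ (p ^ k) + c = b ^+ (p ^ k).+1 ->
  in_PGU (p ^ k) (mx3 [:: [:: 1; 0; b]; [:: b ^+ (p ^ k); 1; c]; [:: 0; 0; 1]]).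
Proof.
move=> pK bq cq bc; have n0 : (0 < p ^ k)%N.
  by rewrite expn_gt0 prime_gt0 // (pcharf_prime pK).
have n2 : (0 < (p ^ k) ^ 2)%N by rewrite expn_gt0 n0.
move: bq cq bc n0 n2 (@in_PGU_gram K p k).
set n := (p ^ k)%N => bq cq bc n0 n2 PGU.
have bnq : (b ^+ n) ^+ (n ^ 2) = b ^+ n by rewrite exprAC bq.
have bnn : (b ^+ n) ^+ n = b by rewrite -exprM mulnn.
(* The inverse has the same shape, with parameters -b and b^(n+1) - c = c^n. *)
apply: (PGU _ (mx3 [:: [:: 1; 0; - b]; [:: - b ^+ n; 1; b ^+ n.+1 - c]; [:: 0; 0; 1]])) => //.
- apply/matrixP => i j; rewrite !mxE !big_ord_recl big_ord0 !mxE.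
  by case: i j => [[|[|[|//]]] ?] [[|[|[|//]]] ?] /=; rewrite ?exprSr; ring.
- move=> i j; rewrite !mxE; case: i j => [[|[|[|//]]] ?] [[|[|[|//]]] ?] /=;
  by rewrite ?expr1n ?expr0n ?(gtn_eqF n2).
- have cE : c ^+ n = b ^+ n * b - c by rewrite -exprSr -bc addrK.
  move=> j l; rewrite /gram !mxE.
  by case: j l => [[|[|[|//]]] ?] [[|[|[|//]]] ?] /=;
     rewrite ?expr1n ?expr0n ?(gtn_eqF n0) ?bnn ?cE /=; ring.
Qed.

(** * Binary forms in Y, Z and reduction modulo H_n *)

(* A truncated homogenization: coefficients of A beyond degree d are dropped. *)
Definition hom_YZ (K : fieldType) d (A : {poly K}) : {mpoly K[3]} :=
  \sum_(j < d.+1) A`_j *: ('X_1 ^+ j * 'X_2 ^+ (d - j)).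

Lemma hom_YZD (K : fieldType) d (A B : {poly K}) :
  hom_YZ d (A + B) = hom_YZ d A + hom_YZ d B.
Proof. by rewrite -big_split; apply: eq_bigr => j _; rewrite coefD scalerDl. Qed.

Lemma hom_YZZ (K : fieldType) d c (A : {poly K}) :
  hom_YZ d (c *: A) = c *: hom_YZ d A.
Proof. by rewrite scaler_sumr; apply: eq_bigr => j _; rewrite coefZ scalerA. Qed.

Lemma hom_YZ_mulXn (K : fieldType) d m (A : {poly K}) :
  hom_YZ (m + d) ('X^m * A) = 'X_1 ^+ m * hom_YZ d A.
Proof.
elim: m => [|m IHm]; first by rewrite expr0 !mul1r.
rewrite !exprS -!mulrA -IHm addSn /hom_YZ big_ord_recl coefXM eqxx scale0r add0r.
rewrite big_distrr; apply: eq_bigr => j _ /=.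
by rewrite coefXM /= -scalerAr exprS mulrA subSS.
Qed.

(** Without the size bound the left side could keep coefficients that the right side drops. *)
Lemma hom_YZ_widen (K : fieldType) d m (A : {poly K}) : (size A <= d.+1)%N ->
  hom_YZ (m + d) A = 'X_2 ^+ m * hom_YZ d A.
Proof.
move=> sA; elim: m => [|m IHm]; first by rewrite expr0 mul1r.
rewrite exprS -mulrA -IHm addSn /hom_YZ big_ord_recr /=.
rewrite nth_default ?scale0r ?addr0; last by rewrite (leq_trans sA) // ltnS leq_addl.
rewrite big_distrr; apply: eq_bigr => j _ /=.
by rewrite -scalerAr mulrCA -exprS subSn // -ltnS (leq_trans (ltn_ord j)) // ltnS leq_addl.
Qed.

Lemma hom_YZ_mul_base (K : fieldType) n d (A : {poly K}) : (size A <= d.+1)%N ->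
  hom_YZ (n.+1 + d) (('X^n + 'X) * A) =
  ('X_1 ^+ n * 'X_2 + 'X_1 * 'X_2 ^+ n) * hom_YZ d A.
Proof.
move=> sA; rewrite mulrDl hom_YZD mulrDl; congr (_ + _).
  by rewrite addSn -addnS hom_YZ_mulXn -mulrA -['X_2]expr1 -(hom_YZ_widen 1 sA) add1n.
rewrite addSn; have := hom_YZ_mulXn (n + d) 1 A; rewrite !expr1 add1n => ->.
by rewrite hom_YZ_widen // mulrA.
Qed.

(** The size bound is carried through the induction because [hom_YZ_mul_base] applies only when
    nothing is truncated. *)
Lemma hom_YZ_monomial (K : fieldType) n i a b : (0 < n)%N ->
  (size (('X^n + 'X) ^+ i * 'X^a : {poly K})%R <= (n * i + a).+1)%N /\
  hom_YZ (n.+1 * i + a + b) (('X^n + 'X) ^+ i * 'X^a : {poly K}) =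
  ('X_1 ^+ n * 'X_2 + 'X_1 * 'X_2 ^+ n) ^+ i * 'X_1 ^+ a * 'X_2 ^+ b.
Proof.
move=> n0; elim: i => [|i [IHs IHi]].
  rewrite !expr0 !mul1r !muln0 !add0n size_polyXn; split=> //.
  have := hom_YZ_mulXn b a (1 : {poly K}); rewrite mulr1 => ->; congr (_ * _).
  have := @hom_YZ_widen K 0 b 1; rewrite addn0 size_poly1 => ->//.
  by rewrite /hom_YZ big_ord1 coef1 scale1r !expr0 !mulr1.
have sT : (size ('X^n + 'X : {poly K})%R <= n.+1)%N.
  by apply: leq_trans (size_polyD _ _) _; rewrite size_polyXn size_polyX geq_max leqnn.
rewrite !exprS -!mulrA; split.
  apply: leq_trans (size_polyMleq _ _) _.
  have := leq_add sT IHs; rewrite mulnS.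
  by move: (size _) (size _) => x y; clear; lia.
have -> : (n.+1 * i.+1 + a + b = n.+1 + (n.+1 * i + a + b))%N by rewrite mulnS !addnA.
rewrite hom_YZ_mul_base ?IHi ?mulrA //.
by rewrite (leq_trans IHs) // ltnS -addnA leq_add ?leq_mul ?leq_addr.
Qed.

Lemma mpolyX3 (K : fieldType) (m : 'X_{1..3}) :
  'X_[m] = 'X_0 ^+ m 0 * 'X_1 ^+ m 1 * 'X_2 ^+ m 2 :> {mpoly K[3]}.
Proof.
rewrite mpolyXE_id !big_ord_recl big_ord0 mulr1 mulrA.
by congr ('X_ _ ^+ m _ * 'X_ _ ^+ m _ * 'X_ _ ^+ m _); apply: val_inj.
Qed.

Lemma mdeg3 (m : 'X_{1..3}) : mdeg m = (m 0%R + m 1%R + m 2%R)%N.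
Proof.
rewrite mdegE !big_ord_recl big_ord0 addn0 addnA.
by congr (m _ + m _ + m _)%N; apply: val_inj.
Qed.

(* Eliminating X through X^(n+1) = Y^n Z + Y Z^n. *)
Lemma herm_reduction (K : fieldType) n d (F : {mpoly K[3]}) : (0 < n)%N ->
  F \is d.-homog -> (forall m, m \in msupp F -> (n.+1 %| m 0%R)%N) ->
  exists (A : {poly K}) Q, (size A <= d.+1)%N /\ F = herm_poly K n * Q + hom_YZ d A.
Proof.
move=> n0 Fd Fm; rewrite [F]mpolyE big_seq.
elim/big_ind: _ => [|F1 F2 [A1 [Q1 [s1 ->]]] [A2 [Q2 [s2 ->]]]|m mF].
- exists 0, 0; rewrite size_poly0 mulr0 add0r; split=> //.
  by rewrite /hom_YZ big1 // => j _; rewrite coef0 scale0r.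
- exists (A1 + A2), (Q1 + Q2); split; last by rewrite hom_YZD mulrDr addrACA.
  by apply: leq_trans (size_polyD _ _) _; rewrite geq_max s1.
have md : (m 0%R + m 1%R + m 2%R = d)%N by rewrite -mdeg3; apply: (dhomog_mf Fd).
have /dvdnP [i mi] := Fm m mF.
have [sA hA] := @hom_YZ_monomial K n i (m 1) (m 2) n0.
set T := 'X_1 ^+ n * 'X_2 + 'X_1 * 'X_2 ^+ n in hA.
pose X : {mpoly K[3]} := 'X_0 ^+ n.+1.
exists (F@_m *: (('X^n + 'X) ^+ i * 'X^(m 1))).
(* The quotient comes from X^i - T^i = (X - T) times this sum, with X - T = -H_n, whence the
   sign. *)
exists (- F@_m *: ((\sum_(l < i) X ^+ (i.-1 - l) * T ^+ l) * 'X_1 ^+ m 1 * 'X_2 ^+ m 2)).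
split.
  by apply: leq_trans (size_scale_leq _ _) _; rewrite (leq_trans sA) // ltnS -md mi -addnA leq_add ?leq_addr // mulnC leq_mul.
have -> : d = (n.+1 * i + m 1%R + m 2%R)%N by rewrite -md mi mulnC.
rewrite hom_YZZ hA mpolyX3 mi mulnC exprM -/X scaleNr mulrN -mulNr -scalerAr -scalerDr.
have -> : - herm_poly K n = X - T by rewrite /herm_poly opprB.
by rewrite !mulrA -subrXX; congr (_ *: _); rewrite !mulrBl subrK.
Qed.

Lemma ev3_hom_Y (K : fieldType) d (A u v : {poly K}) : (size A <= d.+1)%N ->
  ev3 u v 1 (hom_YZ d A) = A \Po v.
Proof.
move=> sA; rewrite raddf_sum comp_polyE (big_ord_widen _ (fun i => A`_i *: v ^+ i) sA).
rewrite [RHS]big_mkcond; apply: eq_bigr => j _ /=.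
rewrite ev3Z rmorphM !rmorphXn /= !ev3X expr1n mulr1.
by case: ltnP => // Aj; rewrite nth_default // scale0r.
Qed.

Lemma ev3_hom_Z (K : fieldType) d (A u w : {poly K}) :
  ev3 u 1 w (hom_YZ d A) = \sum_(j < d.+1) A`_j *: w ^+ (d - j).
Proof.
rewrite raddf_sum; apply: eq_bigr => j _ /=.
by rewrite ev3Z rmorphM !rmorphXn /= !ev3X expr1n mul1r.
Qed.

(** * Counting roots; finite subfields and roots of unity in K *)

Lemma prod_XsubC_exp_dvdp (K : fieldType) (k : K -> nat) (rs : seq K) (B : {poly K}) :
  uniq rs -> (forall c, c \in rs -> ('X - c%:P) ^+ k c %| B) ->
  \prod_(c <- rs) ('X - c%:P) ^+ k c %| B.
Proof.
elim: rs => [|c rs IHrs] /=; first by rewrite big_nil dvd1p.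
case/andP=> crs urs krs; rewrite big_cons Gauss_dvdp.
  by rewrite krs ?mem_head // IHrs // => e ers; rewrite krs // inE ers orbT.
rewrite big_seq; elim/big_ind: _ => [|u v cu cv|e ers]; first exact: coprimep1.
  by rewrite coprimepMr cu.
apply/coprimep_expl/coprimep_expr; rewrite coprimep_XsubC root_XsubC.
by apply: contraNneq crs => <-.
Qed.

Lemma sum_mult_lt_size (K : fieldType) (k : K -> nat) (rs : seq K) (B : {poly K}) :
  B != 0 -> uniq rs -> (forall c, c \in rs -> ('X - c%:P) ^+ k c %| B) ->
  (\sum_(c <- rs) k c < size B)%N.
Proof.
move=> B0 urs krs; apply: leq_trans (dvdp_leq B0 (prod_XsubC_exp_dvdp urs krs)).
elim: {urs krs} rs => [|c rs IHrs]; first by rewrite !big_nil size_poly1.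
rewrite !big_cons size_Mmonic ?monic_neq0 ?rpredX ?monicXsubC //; last first.
  by apply: monic_prod => e _; rewrite rpredX ?monicXsubC.
by rewrite size_exp_XsubC addSn /= -addnS leq_add2l.
Qed.

Lemma separable_roots (K : closedFieldType) (P : {poly K}) : separable_poly P ->
  exists rs, [/\ uniq rs, size rs = (size P).-1 & forall c, c \in rs -> P.[c] = 0].
Proof.
move=> sepP; have P0 := separable_poly_neq0 sepP.
have [rs Prs] := closed_field_poly_normal P; have lP : lead_coef P != 0 by rewrite lead_coef_eq0.
exists rs; split.
- rewrite -separable_prod_XsubC; move: sepP; rewrite {1}Prs.
  by rewrite separable_poly.unlock derivZ coprimepZl ?coprimepZr.
- by rewrite Prs size_scale // size_prod_XsubC.
- by move=> c crs; rewrite Prs hornerZ (rootP _) ?mulr0 // root_prod_XsubC.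
Qed.

Lemma fixed_field_roots (K : closedFieldType) p e : p \in [pchar K] -> (0 < e)%N ->
  exists rs : seq K, [/\ uniq rs, size rs = (p ^ e)%N &
    forall c, c \in rs -> c ^+ (p ^ e) = c].
Proof.
move=> pK e0; have q1 : (1 < p ^ e)%N.
  by rewrite -{1}(expn0 p) ltn_exp2l // prime_gt1 // (pcharf_prime pK).
have sP : separable_poly ('X^(p ^ e) - 'X : {poly K}).
  rewrite separable_poly.unlock derivB derivXn derivX -scaler_nat natrX (pcharf0 pK) expr0n.
  by rewrite (gtn_eqF e0) scale0r sub0r -(scaleN1r (1 : {poly K})) coprimepZr ?oppr_eq0 ?oner_eq0 ?coprimep1.
have [rs [urs srs rrs]] := separable_roots sP.
exists rs; split=> // [|c /rrs].
  by rewrite srs size_polyDl ?size_polyN ?size_polyXn ?size_polyX.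
by rewrite !hornerE => /eqP; rewrite subr_eq0 => /eqP.
Qed.

Lemma prim_root_succ_exists (K : closedFieldType) p k : p \in [pchar K] -> (0 < k)%N ->
  exists z : K, (p ^ k).+1.-primitive_root z.
Proof.
move=> pK k0; set n := (p ^ k)%N.
(* Hence X^(n+1) - 1 has derivative X^n, which is coprime to it. *)
have nK : n.+1%:R = 1 :> K.
  by rewrite -addn1 natrD natrX (pcharf0 pK) expr0n (gtn_eqF k0) add0r.
have sP : separable_poly ('X^(n.+1) - 1 : {poly K}).
  rewrite separable_poly.unlock derivB derivXn derivC subr0 -scaler_nat nK scale1r /=.
  apply/coprimep_expr/coprimepP => D Da Db.
  have : D %| 'X^(n.+1) - ('X^(n.+1) - 1) by rewrite dvdp_sub // exprS dvdp_mulr.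
  by rewrite subKr dvdp1 -size_poly_eq1.
have [rs [urs srs rrs]] := separable_roots sP.
have /hasP[z _ zP] : has (n.+1).-primitive_root rs; last by exists z.
apply: has_prim_root => //; last by rewrite srs size_Xn_sub_1.
by apply/allP => c /rrs; rewrite !hornerE => /eqP; rewrite subr_eq0 -unity_rootE.
Qed.

Lemma root_exists (K : closedFieldType) (e : K) n : exists b, b ^+ n.+1 = e.
Proof.
have [|b /rootP] := @closed_rootP K ('X^(n.+1) - e%:P) _.
  by rewrite size_XnsubC.
by rewrite !hornerE => /eqP; rewrite subr_eq0 => /eqP; exists b.
Qed.

(** At most n of the n^2 elements satisfy c^n + c = 0, and n + (n^2 - n)(n + 1) = n^3. *)
Lemma sum_contact_orders (K : fieldType) n (rs : seq K) : (1 < n)%N ->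
  uniq rs -> size rs = (n ^ 2)%N ->
  (n ^ 3 <= \sum_(c <- rs) (if (c ^+ n + c == 0)%R then 1 else n.+1))%N.
Proof.
move=> n1 urs srs; pose a (c : K) := c ^+ n + c == 0.
have E : (\sum_(c <- rs) (if a c then 1 else n.+1) = size rs + n * count (predC a) rs)%N.
  elim: {urs srs} rs => [|c rs IH]; first by rewrite big_nil muln0.
  by rewrite big_cons IH /=; case: (a c) => /=; rewrite ?mulnDr; lia.
rewrite E srs; have cnt : (count a rs <= n)%N.
  rewrite -size_filter -ltnS.
  have sP : size ('X^n + 'X : {poly K}) = n.+1 by rewrite size_polyDl size_polyXn ?size_polyX.
  rewrite -sP; apply: max_poly_roots; last exact: filter_uniq.
    by rewrite -size_poly_eq0 sP.
  by apply/allP => c; rewrite mem_filter /root !hornerE => /andP[].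
have := count_predC a rs; rewrite srs; move: cnt; move: (count _ _) (count _ _) => x y.
by clear; nia.
Qed.

(** * Homologies and the exponents of X *)

Lemma mat_actMD (K : fieldType) (M : 'M[K]_3) (F G R : {mpoly K[3]}) :
  mat_act M (F * G + R) = mat_act M F * mat_act M G + mat_act M R.
Proof. by rewrite /mat_act rmorphD rmorphM. Qed.

Lemma mat_act_homology_coeff (K : fieldType) (z : K) (F : {mpoly K[3]}) m :
  (mat_act (mx3 [:: [:: z; 0; 0]; [:: 0; 1; 0]; [:: 0; 0; 1]]) F)@_m = z ^+ m 0 * F@_m.
Proof.
set M := mx3 _; have E m' : 'X_[m'] \mPo [tuple \sum_(j < 3) M i j *: 'X_j | i < 3] =
    z ^+ m' 0 *: 'X_[m'] :> {mpoly K[3]}.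
  rewrite mpolyX3 !rmorphM !rmorphXn /= !comp_mpolyXU !(nth_mktuple _ _ (_ : 'I_3)).
  rewrite !big_ord_recl !big_ord0 !mxE /= !scale0r !scale1r !addr0 !add0r.
  by rewrite exprZn -!scalerAl; congr (_ *: ('X_ _ ^+ _ * 'X_ _ ^+ _ * 'X_ _ ^+ _)); apply: val_inj.
rewrite /mat_act comp_mpolyE raddf_sum /=.
have G m' : (F@_m' *: \prod_(i < 3) tnth [tuple \sum_(j < 3) M i j *: 'X_j | i < 3] i ^+ m' i)@_m =
    F@_m' * z ^+ m' 0 * (m' == m)%:R.
  by rewrite -comp_mpolyX E scalerA mcoeffZ mcoeffX.
under eq_bigr do rewrite G.
have [mF|mF] := boolP (m \in msupp F).
  rewrite (bigD1_seq m) ?msupp_uniq //= eqxx mulr1 mulrC big1 ?addr0 // => m' m'm.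
  by rewrite (negPf m'm) mulr0.
rewrite memN_msupp_eq0 // mulr0 big_seq big1 // => m' m'F.
by have [m'm|] := eqVneq m' m; rewrite ?mulr0 //; rewrite -m'm m'F in mF.
Qed.

Lemma dvd_X0 (K : fieldType) (F : {mpoly K[3]}) :
  (forall m, m \in msupp F -> m 0 != 0%N) -> exists G, F = 'X_0 * G.
Proof.
move=> Fm; exists (\sum_(m <- msupp F) F@_m *: 'X_[m - U_(0)]).
rewrite {1}[F]mpolyE big_distrr big_seq [RHS]big_seq /=; apply: eq_bigr => m /Fm m0.
by rewrite -scalerAr -mpolyXD addmC submK // lep1mP.
Qed.

(** Otherwise X would divide F, properly since d > 1. *)
Lemma irreducible_X0_exponent (K : fieldType) d (F : {mpoly K[3]}) : (1 < d)%N ->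
  plane_curve_of_degree d F -> mirreducible F -> exists2 m, m \in msupp F & m 0 = 0%N.
Proof.
move=> d1 [F0 Fd] [_ irrF].
have [/hasP [m mF /eqP m0]|/hasPn Fm] := boolP (has (fun m : 'X_{1..3} => m 0 == 0%N) (msupp F)).
  by exists m.
have [G FG] := dvd_X0 Fm; have X0 : 'X_0 != 0 :> {mpoly K[3]}.
  by rewrite -msize_poly_eq0 msizeX.
have G0 : G != 0 by apply: contraNneq F0 => G0; rewrite FG G0 mulr0.
have := msize_dhomog F0 Fd; rewrite FG msizeM //.
have [] := irrF _ _ FG; rewrite msizeX mdeg1 //.
by move: (mmeasure _ _) d1 => x; clear; lia.
Qed.

(** Each monomial is scaled by a power of z, and all these powers equal c; a monomial free of X
    gives c = 1. *)
Lemma homology_invariant_exponents (K : fieldType) n d (z : K) (F : {mpoly K[3]}) c :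
  (1 < d)%N -> plane_curve_of_degree d F -> mirreducible F -> n.-primitive_root z ->
  mat_act (mx3 [:: [:: z; 0; 0]; [:: 0; 1; 0]; [:: 0; 0; 1]]) F = c *: F ->
  forall m, m \in msupp F -> (n %| m 0%R)%N.
Proof.
move=> d1 Fd irrF zP zF m mF.
have [m1 m1F m10] := irreducible_X0_exponent d1 Fd irrF.
have E m' : m' \in msupp F -> z ^+ m' 0 = c.
  rewrite mcoeff_msupp => m'F; apply: (mulIf m'F).
  by rewrite -mat_act_homology_coeff zF mcoeffZ.
by rewrite (prim_order_dvd zP) E // -(E _ m1F) m10 expr0.
Qed.

(** * The binary remainder of an invariant form *)

(** The inverse affine substitution sends X^m to a nonzero constant times (X - c)^m. *)
Lemma dvdp_comp_affine (K : fieldType) m (a c : K) (B : {poly K}) : a != 0 ->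
  'X^m %| B \Po (a *: 'X + c%:P) -> ('X - c%:P) ^+ m %| B.
Proof.
move=> a0 /dvdpP [D BD]; pose L := a^-1 *: ('X - c%:P).
have -> : B = (B \Po (a *: 'X + c%:P)) \Po L.
  by rewrite -comp_polyA comp_polyD comp_polyZ comp_polyC comp_polyX scalerA divff //
             scale1r subrK comp_polyXr.
by rewrite BD comp_polyM rmorphXn /= comp_polyX exprZn dvdp_mull // dvdpZr ?expf_neq0 ?invr_eq0.
Qed.

Lemma ev3_swap (K : fieldType) (u v w : {poly K}) F :
  ev3 u v w (mat_act (mx3 [:: [:: 1; 0; 0]; [:: 0; 0; 1]; [:: 0; 1; 0]]) F) = ev3 u w v F.
Proof. by rewrite ev3_mat_act !mxE /= !scale0r !scale1r !addr0 !add0r. Qed.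

Lemma ev3_unipotent (K : fieldType) (a b c : K) (u v w : {poly K}) F :
  ev3 u v w (mat_act (mx3 [:: [:: 1; 0; b]; [:: a; 1; c]; [:: 0; 0; 1]]) F) =
  ev3 (u + b *: w) (a *: u + v + c *: w) w F.
Proof. by rewrite ev3_mat_act !mxE /= !scale0r !scale1r !addr0 !add0r. Qed.

Section Reduced.
Variables (K : closedFieldType) (p k d : nat) (F Q : {mpoly K[3]}) (A : {poly K}).
Let n := (p ^ k)%N.
Hypotheses (pK : p \in [pchar K]) (k0 : (0 < k)%N) (invF : PGU_invariant n F).
Hypotheses (sA : (size A <= d.+1)%N) (FE : F = herm_poly K n * Q + hom_YZ d A).

Let n1 : (1 < n)%N.
Proof. by rewrite /n -{1}(expn0 p) ltn_exp2l // prime_gt1 // (pcharf_prime pK). Qed.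

(** Along the Hermitian curve the multiple of H_n disappears, so F is governed by A alone. *)
Lemma reduced_at_Y u v : ev3 u v 1 (herm_poly K n) = 0 -> ev3 u v 1 F = A \Po v.
Proof. by move=> H0; rewrite FE rmorphD rmorphM /= H0 mul0r add0r ev3_hom_Y. Qed.

Lemma reduced_at_Z u w : ev3 u 1 w (herm_poly K n) = 0 ->
  ev3 u 1 w F = \sum_(j < d.+1) A`_j *: w ^+ (d - j).
Proof. by move=> H0; rewrite FE rmorphD rmorphM /= H0 mul0r add0r ev3_hom_Z. Qed.

Lemma reduced_at_001 : ev3 0 0 1 F = (A`_0)%:P.
Proof.
rewrite reduced_at_Y; first by rewrite -polyC0 comp_polyCr horner_coef0.
by rewrite ev3_herm !expr0n (gtn_eqF (ltnW n1)) !mul0r subr0 addr0.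
Qed.

Lemma reduced_at_010 : ev3 0 1 0 F = (A`_d)%:P.
Proof.
rewrite reduced_at_Z; last first.
  by rewrite ev3_herm !expr0n (gtn_eqF (ltnW n1)) !mulr0 subr0 addr0.
rewrite big_ord_recr /= subnn expr0 big1 ?add0r ?alg_polyC // => j _.
by rewrite expr0n subn_eq0 leqNgt ltn_ord scaler0.
Qed.

(** The coefficients A_0 and A_d are the values of F at the exchanged points (0,0,1) and (0,1,0).
    The second relation compares F at (b,y,1) and (b,1,y). *)
Lemma reduced_swap : exists2 c, A`_0 = c * A`_d /\ A`_d = c * A`_0 &
  forall y, y ^+ (n ^ 2) = y -> y != 0 -> y ^+ d * A.[y^-1] = c * A.[y].
Proof.
have [c Sc] := invF (swap_in_PGU k pK).
have E u v w : ev3 u w v F = c *: ev3 u v w F by rewrite -ev3_swap Sc ev3Z.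
exists c.
  split; apply: polyC_inj; rewrite polyCM mul_polyC.
    by rewrite -reduced_at_001 -reduced_at_010 E.
  by rewrite -reduced_at_001 -reduced_at_010 E.
(* This b puts both (b,y,1) and (b,1,y) on the curve, whose equation is symmetric in Y and Z. *)
move=> y yq y0; have [b bE] := root_exists (y ^+ n + y) n.
apply: polyC_inj; have := E b%:P y%:P 1.
rewrite reduced_at_Y; last first.
  by rewrite ev3_herm expr1n !mulr1 -[b%:P ^+ _]polyC_exp bE polyCD polyC_exp subrr.
rewrite reduced_at_Z; last first.
  by rewrite ev3_herm expr1n !mul1r -[b%:P ^+ _]polyC_exp bE polyCD polyC_exp [X in X - _]addrC subrr.
rewrite comp_polyCr -mul_polyC -polyCM => <-.
rewrite (horner_coef_wide _ sA) big_distrr rmorph_sum; apply: eq_bigr => j _ /=.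
rewrite -polyC_exp -mul_polyC -polyCM; congr _%:P.
rewrite mulrCA; congr (_ * _).
by rewrite exprVn -expfB_cond // (negPf y0) add0n -ltnS ltn_ord.
Qed.

(* (X,0,1) parametrizes the curve at (0,0,1) to order n; a unipotent element moves
   this jet to the rational point (b,c,1). *)
Lemma reduced_contact (c : K) : c ^+ (n ^ 2) = c ->
  ('X - c%:P) ^+ (if c ^+ n + c == 0 then 1%N else n.+1) %| A - (A`_0)%:P.
Proof.
move=> cq; have [b bE] := root_exists (c ^+ n + c) n.
have eN : (c ^+ n + c) ^+ n = c ^+ n + c.
  by rewrite exprD_pchar_exp // -exprM mulnn cq addrC.
(* As b^(n+1) = c^n + c is fixed by n-th powers, b^n b^(n^2) = (b^(n+1))^n = b^(n+1). *)
have bq : b ^+ (n ^ 2) = b.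
  have [->|b0] := eqVneq b 0; first by rewrite expr0n expn_eq0 (gtn_eqF (ltnW n1)).
  apply: (mulfI (expf_neq0 n b0)).
  by rewrite -exprD -mulnn -mulSn exprM -exprSr bE eN.
have PGU := unipotent_in_PGU pK bq cq (esym bE).
have [x Fx] := invF PGU; have [_ _ [y Hy]] := PGU.
set M := mx3 _ in Fx Hy; rewrite -/n in Hy.
(* The unipotent matrix fixes the vector (0,1,0), so x fixes A_d, the value of F there; the swap
   carries this over to A_0. *)
have xA : x * A`_0 = A`_0.
  have [s [A0 Ad] _] := reduced_swap.
  suff xd : x * A`_d = A`_d by rewrite A0 mulrCA xd.
  apply: polyC_inj; rewrite polyCM mul_polyC -reduced_at_010 -ev3Z -Fx ev3_unipotent.
  by rewrite !scaler0 !addr0 add0r.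
(* On (X,0,1) every term containing H_n is a multiple of X^(n+1). What remains is A(b^n X + c) on
   one side and x A_0 = A_0 on the other. *)
have : 'X^(n.+1) %| (A - (A`_0)%:P) \Po (b ^+ n *: 'X + c%:P).
  have E := congr1 (ev3 'X 0 1) Fx; rewrite ev3Z {2}FE FE in E.
  rewrite mat_actMD Hy !rmorphD !rmorphM /= ev3Z ev3_herm_X01 ?(ltnW n1) // in E.
  rewrite !ev3_unipotent !ev3_hom_Y // -polyC0 comp_polyCr polyC0 addr0 horner_coef0 in E.
  rewrite !alg_polyC -/n in E.
  move/(canRL (addKr _)): E => E.
  rewrite comp_polyB comp_polyC E -!mul_polyC mulrDr -polyCM xA.
  set q1 := ev3 _ _ _ _; set q2 := ev3 _ _ _ _; set X := 'X^_.
  suff -> : - (y%:P * - X * q1) + (x%:P * (- X * q2) + (A`_0)%:P) - (A`_0)%:P =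
    X * (y%:P * q1 - x%:P * q2) by exact: dvdp_mulIl.
  by ring.
case: ifP => [c0|c0]; last first.
  apply: dvdp_comp_affine; rewrite expf_neq0 //; apply: contraFneq c0 => b0.
  by rewrite -bE b0 expr0n.
(* Here the substitution degenerates to the constant c, and only the equality A(c) = A_0
   survives. *)
have b0 : b = 0 by move: (eqP c0); rewrite -bE => /eqP; rewrite expf_eq0 => /andP [_ /eqP].
rewrite b0 expr0n (gtn_eqF (ltnW n1)) scale0r add0r comp_polyCr => Xd.
rewrite expr1 dvdp_XsubCl rootE; move: Xd.
by rewrite exprS => /(dvdp_trans (dvdp_mulIl _ _)); rewrite -['X]subr0 dvdp_XsubCl rootE hornerC.
Qed.

Lemma reduced_size : A - (A`_0)%:P != 0 -> (n ^ 3 < size (A - (A`_0)%:P)%R)%N.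
Proof.
move=> B0; have k2 : (0 < k * 2)%N by rewrite muln_gt0 k0.
have [rs [urs srs rq]] := fixed_field_roots pK k2.
rewrite expnM -/n in srs rq.
apply: leq_ltn_trans (sum_contact_orders n1 urs srs) _.
by apply: sum_mult_lt_size => // c /rq cq; apply: reduced_contact.
Qed.

Lemma reduced_eq0 : (0 < d <= n ^ 3)%N -> A = 0.
Proof.
case/andP=> d0 dn; have [s [A0 Ad] sy] := reduced_swap.
(* If A_0 = 0, the swap gives A_d = 0, so A has size at most d <= n^3, too small for [reduced_size]
   unless A = 0. *)
have [a0|a0] := eqVneq A`_0 0.
  apply/eqP; apply: contraTT dn => nzA; rewrite -ltnNge.
  have := reduced_size; rewrite a0 subr0 => /(_ nzA) ltA; apply: leq_trans ltA _.
  apply/leq_sizeP => j; rewrite leq_eqVlt => /orP [/eqP <-|dj].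
    by rewrite Ad a0 mulr0.
  by rewrite nth_default // (leq_trans sA).
have B0 : A - (A`_0)%:P != 0.
  apply: contraNneq a0 => /eqP; rewrite subr_eq0 => /eqP AE.
  by rewrite A0 AE coefC (gtn_eqF d0) mulr0.
have {dn} dE : d = (n ^ 3)%N.
  apply/eqP; rewrite eqn_leq dn /= -ltnS; apply: leq_trans (reduced_size B0) _.
  apply: leq_trans (size_polyD _ _) _; rewrite geq_max sA size_polyN.
  by apply: leq_trans (size_polyC_leq1 _) _.
have Aq y : y ^+ (n ^ 2) = y -> A.[y] = A`_0.
  move=> yq; have := reduced_contact yq => /(dvdp_trans _) H.
  have : ('X - y%:P) %| A - (A`_0)%:P.
    by apply: H; case: ifP => _; rewrite ?expr1 // exprS dvdp_mulIl.
  by rewrite dvdp_XsubCl rootE !hornerE subr_eq0 => /eqP.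
(* Since A is constant on F_q, the swap relation becomes y^d = s, and y^d = y^(n^3) = y^n. *)
have sE y : y ^+ (n ^ 2) = y -> y != 0 -> y ^+ n = s.
  move=> yq y0; have := sy y yq y0; rewrite !Aq ?exprVn ?yq // => /(mulIf a0).
  by rewrite dE (expnD n 2 1) exprM yq expn1.
have k2 : (0 < k * 2)%N by rewrite muln_gt0 k0.
have [rs [urs srs rq]] := fixed_field_roots pK k2.
(* Such y exists because F_q has n^2 >= 4 elements; then y^n = s = 1^n, and injectivity of the n-th
   power map contradicts y != 1. *)
have {urs srs} [y yrs /norP [y0 y1]] : exists2 y, y \in rs & ~~ ((y == 0) || (y == 1)).
  apply/hasP; have := has_predC [pred y : K | (y == 0) || (y == 1)] rs => /= ->.
  apply/allP => rs01; have : (size rs <= size [:: 0; 1 : K]%R)%N.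
    by apply: uniq_leq_size => // y /rs01 /=; rewrite !inE.
  by rewrite srs expnM -/n /= leqNgt (@leq_trans (2 ^ 2)%N) // leq_exp2r.
have yq : y ^+ (n ^ 2) = y by rewrite /n -expnM rq.
move/eqP: (sE y yq y0); rewrite -(sE 1) ?expr1n ?oner_eq0 //.
rewrite -subr_eq0 -[X in _ - X](expr1n _ n) -exprB_pchar_exp // expf_eq0 subr_eq0 => /andP [_ y1'].
by rewrite y1' in y1.
Qed.
End Reduced.

(** * Invariant irreducible curves of degree at most n^3, and the theorem *)

Lemma invariant_curve_is_herm (K : closedFieldType) p k d (F : {mpoly K[3]}) :
  p \in [pchar K] -> (0 < k)%N -> (1 < d <= (p ^ k) ^ 3)%N ->
  inv_irr_curve (p ^ k) d F -> exists c : K, F = c *: herm_poly K (p ^ k).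
Proof.
move=> pK k0 /andP [d1 dn] [Fd irrF invF].
have n1 : (1 < p ^ k)%N.
  by rewrite -{1}(expn0 p) ltn_exp2l // prime_gt1 // (pcharf_prime pK).
have [z zP] := prim_root_succ_exists pK k0.
have [c Fc] := invF _ (homology_in_PGU pK (prim_expr_order zP)).
have Fm := homology_invariant_exponents d1 Fd irrF zP Fc.
have [A [Q [sA FE]]] := herm_reduction (ltnW n1) Fd.2 Fm.
have A0 : A = 0.
  by apply: (reduced_eq0 pK k0 invF sA FE); rewrite ltnW.
have {FE} FE : F = herm_poly K (p ^ k) * Q.
  by rewrite FE A0 /hom_YZ big1 ?addr0 // => j _; rewrite coef0 scale0r.
have [|] := irrF.2 _ _ FE.
  by rewrite (msize_dhomog (herm_neq0 K (ltnW n1)) (herm_homog K _)).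
by move/msize1_polyC => QE; exists (Q@_0%MM); rewrite FE {1}QE mulrC mul_mpolyC.
Qed.

Theorem mainTheorem10
  (p k : nat) (K : closedFieldType)
  (hp : prime p) (hk : (0 < k)%N)
  (hchar : p \in [pchar K])
  (halg : forall x : K, exists m : nat, (0 < m)%N /\ x ^+ (p ^ m) = x) :
  let n := (p ^ k)%N in
  let q := (n ^ 2)%N in
  (* d(PGU(3,n)) = n+1 *)
  inv_irr_curve n n.+1 (herm_poly K n) /\
  (forall (d : nat) (F : {mpoly K[3]}),
      (2 <= d <= n)%N -> ~ inv_irr_curve n d F) /\
  (* epsilon(PGU(3,n)) = qn - n, i.e. d'(PGU(3,n)) = n + 1 + (qn - n) *)
  (exists F : {mpoly K[3]}, inv_irr_curve n (n.+1 + (q * n - n)) F) /\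
  (forall (d : nat) (F : {mpoly K[3]}),
      (n.+1 < d < n.+1 + (q * n - n))%N -> ~ inv_irr_curve n d F) /\
  (* H_n is the only invariant irreducible curve of degree n+1 *)
  (forall F : {mpoly K[3]}, inv_irr_curve n n.+1 F ->
      exists c : K, F = c *: herm_poly K n).
Proof.
move=> n q; have n1 : (1 < n)%N by rewrite /n -{1}(expn0 p) ltn_exp2l // prime_gt1.
have n0 := ltnW n1; have n3n : (n < n ^ 3)%N by rewrite -{1}(expn1 n) ltn_exp2l.
(* The natural-number subtraction is not truncated, because n < n^3. *)
have degE : (n.+1 + (q * n - n) = (n ^ 3).+1)%N.
  by rewrite /q -expnSr addSn subnKC // ltnW.
(* Both degree gaps, below n+1 and between n+1 and n^3 + 1, follow from this. *)
have degree d (F : {mpoly K[3]}) : (1 < d <= n ^ 3)%N -> inv_irr_curve n d F -> d = n.+1.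
  move=> dn [[F0 Fd] irrF invF].
  have [c Fc] := invariant_curve_is_herm hchar hk dn (And3 (conj F0 Fd) irrF invF).
  by apply: (dhomog_uniq F0 Fd); rewrite Fc rpredZ // herm_homog.
split; [|split; [|split; [|split]]].
- split; first by split; [exact: herm_neq0 | exact: herm_homog].
    exact: herm_irreducible.
  by move=> M [].
- move=> d F /andP [d1 dn] /degree; rewrite d1 (leq_trans dn (ltnW n3n)) => /(_ isT) dE.
  by rewrite dE ltnn in dn.
- have n30 : (0 < n ^ 3)%N by rewrite expn_gt0 n0.
  exists (herm_poly K (n ^ 3)); rewrite degE; split.
  + by split; [exact: herm_neq0 | exact: herm_homog].
  + by apply: herm_irreducible; apply: leq_ltn_trans n3n.
  + exact: herm_cube_invariant.
- move=> d F; rewrite degE ltnS => /andP [nd dn] /degree.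
  rewrite dn andbT (leq_trans _ nd) // => /(_ isT) dE.
  by rewrite dE ltnn in nd.
- by move=> F; apply: invariant_curve_is_herm; rewrite // ltnS n0.
Qed.
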